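(* Let $\alpha,\beta,\gamma\in\mathbb{R}$ with $\gamma\neq 0$, let $X=\begin{pmatrix}\beta&\alpha\\ \gamma&-\beta\end{pmatrix}$, $\begin{pmatrix}a_t&b_t\\ c_t&d_t\end{pmatrix}=e^{tX}$ and $g_t(z)=\frac{a_tz+b_t}{c_tz+d_t}$ for $t\in\mathbb{R}$, $z\in\mathbb{C}_+$. Let $M_0$ be a Herglotz function, $M_t=g_t\circ M_0$, let $\mu_t$ be the measure in the Herglotz representation of $M_t$ and $\mu_t^{sc}$ its singularly continuous part (with respect to Lebesgue measure). Let $\kappa\in(0,1)$, assume that the set $\mathcal{A}_\kappa(M_0)$ defined in the context is a Borel set of positive Lebesgue measure, and let $\mu_t^{sc}=\mu_t^{sc,\kappa\text{-}c}+\mu_t^{sc,\kappa\text{-}s}$ be the decomposition of $\mu_t^{sc}$ into its $\kappa$-continuous and $\kappa$-singular parts. Then, for every bounded Borel set $\Delta\subset\mathbb{R}$, and for all $t$ with $0\neq|t|<\pi/(2\sqrt{\det(X)})$ if $\det(X)>0$, respectively all $0\neq t\in\mathbb{R}$ if $\det(X)\le0$, $$\mu_t^{sc}(\Delta\cap\mathcal{A}_\kappa(M_0))=\mu_t^{sc,\kappa\text{-}c}(\Delta\cap\mathcal{A}_\kappa(M_0)).$$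
   Context: $\mathbb{C}_+$ is the open upper half-plane. A Herglotz function is an analytic map $M:\mathbb{C}_+\to\mathbb{C}_+$; it has a unique representation $M(z)=Az+B+\int_{\mathbb{R}}d\mu(\lambda)\left(\frac1{\lambda-z}-\frac{\lambda}{1+\lambda^2}\right)$ with $A\ge0$, $B\in\mathbb{R}$ and $\mu$ a Borel measure on $\mathbb{R}$ with $\int_{\mathbb{R}}\frac{d\mu(\lambda)}{1+\lambda^2}<\infty$; $\mu$ is the measure in the Herglotz representation of $M$. For $\kappa\in(0,1)$ set $\mathcal{S}_\kappa(M_0)=\{\lambda\in\mathbb{R}:\liminf_{\varepsilon\downarrow0}\varepsilon^{\kappa-1}\mathrm{Im}\,M_0(\lambda+i\varepsilon)\in(0,\infty)\}$ and $\mathcal{A}_\kappa(M_0)=\bigcup_{\kappa'\in[\kappa,1)}\mathcal{S}_{\kappa'}(M_0)$. $h^\kappa$ denotes $\kappa$-dimensional Hausdorff measure on $\mathbb{R}$, $h^\kappa(S)=\lim_{\delta\downarrow0}\inf\sum_{n}|I_n|^\kappa$, the infimum over countable covers of $S$ by intervals of length less than $\delta$. A Borel measure is $\kappa$-continuous if it gives zero weight to all sets with zero $h^\kappa$ measure, and $\kappa$-singular if it is supported on a set of zero $h^\kappa$ measure (i.e. the complement of that set has measure zero). Every Borel measure $\nu$ on $\mathbb{R}$ with $\int_{\mathbb{R}}\frac{d\nu(\lambda)}{1+\lambda^2}<\infty$ decomposes uniquely as $\nu=\nu^{\kappa\text{-}c}+\nu^{\kappa\text{-}s}$ with $\nu^{\kappa\text{-}c}$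 $\kappa$-continuous and $\nu^{\kappa\text{-}s}$ $\kappa$-singular. *)

(* Defs.v *)
From HB Require Import structures.
From mathcomp Require Import all_boot all_order all_algebra.
From mathcomp Require Import complex.
From mathcomp Require Import all_classical all_reals all_analysis.

Set Implicit Arguments.
Unset Strict Implicit.
Unset Printing Implicit Defensive.

Import Order.TTheory GRing.Theory Num.Theory.
Import numFieldNormedType.Exports.

Local Open Scope classical_set_scope.
Local Open Scope ring_scope.
Local Open Scope complex_scope.

Notation borel_measure R := {measure set (measurableTypeR R) -> \bar R}.

Section Herglotz.
Variable R : realType.

Definition upper_half_plane : set R[i] := [set z | 0 < complex.Im z].

(* [R[i]^o] is [R[i]] as a normed module over itself, so that [derivable _ z 1]
   is complex differentiability at [z].  Functions on the half-plane are
   represented by total functions, whose values elsewhere are irrelevant. *)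
Definition herglotz (M : R[i] -> R[i]) : Prop :=
  forall z, upper_half_plane z ->
    derivable (M : R[i]^o -> R[i]^o) z 1 /\ upper_half_plane (M z).

Definition cintegral (mu : borel_measure R) (f : R -> R[i]) : R[i] :=
  (\int[mu]_l complex.Re (f l)) +i* (\int[mu]_l complex.Im (f l)).

Definition poisson_finite (mu : borel_measure R) : Prop :=
  (\int[mu]_l ((1 + l ^+ 2)^-1)%:E < +oo)%E.

Definition herglotz_measure (M : R[i] -> R[i]) (mu : borel_measure R) : Prop :=
  poisson_finite mu /\
  exists A B : R, 0 <= A /\
    forall z, upper_half_plane z ->
      M z = A%:C * z + B%:C
            + cintegral mu (fun l => (l%:C - z)^-1 - (l / (1 + l ^+ 2))%:C).

End Herglotz.

Section Moebius.
Variable R : realType.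

Definition sl2_generator (alpha beta gamma : R) : 'M[R]_2 :=
  \matrix_(i, j) (if i == 0 then if j == 0 then beta else alpha
                  else if j == 0 then gamma else - beta).

Definition mxexp (X : 'M[R]_2) : 'M[R]_2 :=
  limn (series (fun n => n`!%:R^-1 *: X ^+ n)).

Definition moebius (G : 'M[R]_2) (z : R[i]) : R[i] :=
  ((G 0 0)%:C * z + (G 0 1)%:C) / ((G 1 0)%:C * z + (G 1 1)%:C).

End Moebius.

Section BoundarySets.
Variable R : realType.

Definition S_set (kappa : R) (M : R[i] -> R[i]) : set (measurableTypeR R) :=
  [set l : R |
    let L := limf_einf (fun e : R =>
               (e `^ (kappa - 1) * complex.Im (M (l +i* e)))%:E) (0^'+) in
    (0 < L)%E /\ (L < +oo)%E].

Definition A_set (kappa : R) (M : R[i] -> R[i]) : set (measurableTypeR R) :=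
  \bigcup_(k in [set k : R | kappa <= k < 1]) S_set k M.

End BoundarySets.

Section Hausdorff.
Variable R : realType.
Local Open Scope ereal_scope.

(* The empty set is an interval, so finite covers are included. *)
Definition hausdorff_premeasure (kappa delta : R) (S : set R) : \bar R :=
  ereal_inf [set \sum_(0 <= n <oo) (lebesgue_measure (I n) `^ kappa)
            | I in [set I : nat -> set R |
                [/\ forall n, is_interval (I n),
                    forall n, lebesgue_measure (I n) < delta%:E
                  & S `<=` \bigcup_n I n]]].

Definition hausdorff_measure (kappa : R) (S : set R) : \bar R :=
  lim (hausdorff_premeasure kappa delta S @[delta --> 0%R^'+]).

End Hausdorff.

Section Decompositions.
Variable R : realType.
Implicit Types mu nu : borel_measure R.
Local Open Scope ereal_scope.

(* Library measures are total functions with unspecified values off the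
   sigma-algebra, so sets are required to be Borel.  This loses nothing: every
   set of zero Hausdorff measure lies in a Borel set of zero Hausdorff
   measure. *)
Definition kappa_continuous (kappa : R) nu : Prop :=
  forall S : set (measurableTypeR R), measurable S ->
    hausdorff_measure kappa S = 0 -> nu S = 0.

Definition kappa_singular (kappa : R) nu : Prop :=
  exists S : set (measurableTypeR R),
    [/\ measurable S, hausdorff_measure kappa S = 0 & nu (~` S) = 0].

Definition kappa_decomposition (kappa : R) nu nuc nus : Prop :=
  [/\ kappa_continuous kappa nuc, kappa_singular kappa nus
    & forall B : set (measurableTypeR R), measurable B ->
        nu B = nuc B + nus B].

Definition singularly_continuous nu : Prop :=
  (forall x : R, nu [set x] = 0) /\
  exists N : set (measurableTypeR R),
    [/\ measurable N, lebesgue_measure N = 0 & nu (~` N) = 0].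

Definition pure_point nu : Prop :=
  exists C : set (measurableTypeR R), countable C /\ nu (~` C) = 0.

Definition sc_part mu musc : Prop :=
  singularly_continuous musc /\
  exists muac mupp : borel_measure R,
    [/\ muac `<< lebesgue_measure, pure_point mupp
      & forall B : set (measurableTypeR R), measurable B ->
          mu B = muac B + musc B + mupp B].

End Decompositions.

(* Main.v *)
(* On A_kappa(M_0) one has Im M_0(l + ie) >= c e^(1 - kappa) for small e.  Since
   the lower left entry c_t of exp(tX) does not vanish,
   Im M_t = det(exp(tX)) Im M_0 / |c_t M_0 + d_t|^2 is at most a constant times
   1 / Im M_0, hence O(e^(kappa - 1)) at l + ie, and the Poisson kernel bound
   mu_t[l - e, l + e] <= 2 e Im M_t(l + ie) gives mu_t[l - e, l + e] = O(e^kappa)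
   at every l in A_kappa(M_0).  By the mass distribution principle mu_t, and so
   its part mu_t^{sc, kappa-s}, vanishes on A_kappa(M_0) within any set of zero
   kappa-dimensional Hausdorff measure. *)
Require Import Defs.
From HB Require Import structures.
From mathcomp Require Import all_boot all_order all_algebra.
From mathcomp Require Import complex ring lra.
From mathcomp Require Import all_classical all_reals all_analysis.
From mathcomp Require Import measurable_realfun.

Set Implicit Arguments.
Unset Strict Implicit.
Unset Printing Implicit Defensive.

Import Order.TTheory GRing.Theory Num.Theory.
Import numFieldNormedType.Exports.

Local Open Scope classical_set_scope.
Local Open Scope ring_scope.
Local Open Scope complex_scope.

(** * Hausdorff-null sets and the mass distribution principle *)

Section HausdorffNullSets.
Variable R : realType.
Implicit Types (kappa delta : R) (S E : set R).

(** Convexity puts the segment between any two points of [I] inside [I], so their distance is at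
    most the length of [I]. *)
Lemma interval_sub_closed_ball (I : set R) (l r : R) :
  is_interval I -> I l -> (lebesgue_measure I <= r%:E)%E ->
  I `<=` `[l - r, l + r]%classic.
Proof.
move=> itvI Il Ir x Ix.
have len a b : I a -> I b -> a <= b -> b - a <= r.
  move=> Ia Ib ab.
  have sub : `[a, b]%classic `<=` I.
    by move=> y /=; rewrite in_itv/= => yab; exact: (itvI a b).
  have : (lebesgue_measure (`[a, b]%classic : set R) <= r%:E)%E.
    apply: le_trans Ir; apply: le_measure; rewrite ?inE //.
    exact: is_interval_measurable.
  rewrite lebesgue_measure_itv/= lte_fin; case: ltP => [_|ba].
    by rewrite -EFinB lee_fin.
  rewrite lee_fin; apply: le_trans; lra.
rewrite /= in_itv/=; case: (leP l x) => [lx|/ltW xl].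
  have := len _ _ Il Ix lx; lra.
have := len _ _ Ix Il xl; lra.
Qed.

Lemma hausdorff_premeasure_ge0 kappa delta S :
  (0 <= hausdorff_premeasure kappa delta S)%E.
Proof.
apply: le_ereal_inf_tmp => _ [I _ <-].
by apply: nneseries_ge0 => n _ _; exact: poweR_ge0.
Qed.

Lemma hausdorff_premeasure_nincr kappa S (delta delta' : R) :
  delta <= delta' ->
  (hausdorff_premeasure kappa delta' S <= hausdorff_premeasure kappa delta S)%E.
Proof.
move=> dd'; apply: ereal_inf_le_tmp => _ [I [itvI Id SI] <-]; exists I => //.
split=> // n; apply: lt_le_trans (Id n) _; by rewrite lee_fin.
Qed.

(** The premeasure grows as [delta] shrinks, so its limit at 0 from the right dominates each of its
    values. *)
Lemma hausdorff_null_premeasure kappa delta S :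
  hausdorff_measure kappa S = 0%E -> 0 < delta ->
  hausdorff_premeasure kappa delta S = 0%E.
Proof.
move=> S0 d0; apply/eqP; rewrite eq_le hausdorff_premeasure_ge0 andbT -S0.
apply: lime_ge.
  apply: nonincreasing_at_right_is_cvge; near=> b => x y _ _.
  exact: hausdorff_premeasure_nincr.
near=> e; apply: hausdorff_premeasure_nincr; near: e.
exact: nbhs_right_le.
Unshelve. all: by end_near. Qed.

(* Discard from a cover of [S] the intervals that miss [E]; the others lie in
   closed balls centred in [E]. *)
Lemma mass_distribution (mu : borel_measure R) kappa delta (C : R) S E :
  0 < kappa -> 0 < delta -> 0 <= C ->
  hausdorff_measure kappa S = 0%E ->
  (forall l, E l -> forall e : R, 0 < e < delta ->
     (mu `[(l - e)%R, (l + e)%R]%classic <= (C * e `^ kappa)%:E)%E) ->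
  mu.-negligible (S `&` E : set (measurableTypeR R)).
Proof.
move=> k0 d0 C0 S0 muE.
have cover (eta : R) : 0 < eta ->
    exists U : set (measurableTypeR R),
      [/\ measurable U, S `&` E `<=` U & (mu U <= eta%:E)%E].
  (* Dividing by [C + 1] instead of [C] allows [C = 0]. *)
  move=> eta0; have C1 : 0 < C + 1 by lra.
  have : (hausdorff_premeasure kappa delta S < (eta / (C + 1))%:E)%E.
    by rewrite hausdorff_null_premeasure// lte_fin divr_gt0.
  move=> /ereal_inf_lt[_ [I [itvI Id SI] <-] sumI].
  pose J n : set (measurableTypeR R) :=
    if `[< I n `&` E !=set0 >] then I n else set0.
  have mJ n : measurable (J n).
    rewrite /J; case: asboolP => // _.
    exact: is_interval_measurable.
  have muJ n : (mu (J n) <= C%:E * (lebesgue_measure (I n) `^ kappa))%E.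
    rewrite /J; case: asboolP => [[l [Il El]]|_]; last first.
      by rewrite measure0 mule_ge0// ?lee_fin// poweR_ge0.
    have Ifin : lebesgue_measure (I n) \is a fin_num.
      rewrite ge0_fin_numE; last exact: measure_ge0.
      by apply: lt_trans (Id n) _; rewrite ltry.
    have := Id n; rewrite -(fineK Ifin) lte_fin poweR_EFin -EFinM.
    set r := fine _ => rd.
    have r0 : 0 <= r by rewrite fine_ge0.
    have ball s : r <= s -> 0 < s -> s < delta ->
        (mu (I n) <= (C * s `^ kappa)%:E)%E.
      move=> rs s0 sd; apply: le_trans (muE l El s _); last by rewrite s0.
      apply: le_measure; rewrite ?inE//.
        exact: is_interval_measurable.
      by apply: interval_sub_closed_ball => //; rewrite -(fineK Ifin) lee_fin.
    (* The growth hypothesis concerns positive radii only; an interval of length zero is therefore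
       enclosed in arbitrarily small balls. *)
    move: r0; rewrite le0r => /orP[/eqP r0|r0]; last exact: ball.
    rewrite r0 powR0 ?gt_eqF// mulr0.
    apply/lee_addgt0Pr => e e0; rewrite add0e.
    (* The first bound makes the radius admissible; the second gives s^kappa <= e / (C + 1), hence C
       s^kappa <= e. *)
    pose s := Num.min (delta / 2) ((e / (C + 1)) `^ kappa^-1).
    have s0 : 0 < s.
      rewrite lt_min; apply/andP; split; first lra.
      by rewrite powR_gt0// divr_gt0.
    apply: le_trans (ball s _ s0 _) _.
    - by rewrite r0 ltW.
    - by rewrite gt_min; apply/orP; left; lra.
    rewrite lee_fin.
    have : s `^ kappa <= e / (C + 1).
      have -> : e / (C + 1) = ((e / (C + 1)) `^ kappa^-1) `^ kappa.
        by rewrite -powRrM mulVf ?gt_eqF// powRr1// divr_ge0 ?ltW.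
      apply: ge0_ler_powR; rewrite ?nnegrE ?powR_ge0//; try exact: ltW.
      by rewrite ge_min lexx orbT.
    rewrite ler_pdivlMr// => h; apply: le_trans h.
    rewrite mulrDr mulr1 [C * _]mulrC lerDl; exact: powR_ge0.
  exists (\bigcup_n J n); split.
  - exact: bigcup_measurable.
  - move=> x [Sx Ex]; have [n _ Inx] := SI x Sx; exists n => //.
    by rewrite /J; case: asboolP => // -[]; exists x.
  - apply: (@le_trans _ _ (\sum_(0 <= n <oo) mu (J n))%E).
      apply: measure_sigma_subadditive => //.
      exact: bigcup_measurable.
    apply: (@le_trans _ _
        (\sum_(0 <= n <oo) (C%:E * (lebesgue_measure (I n) `^ kappa)))%E).
      by apply: lee_nneseries => n _ //; exact: measure_ge0.
    rewrite nneseriesZl; last by move=> n _; exact: poweR_ge0.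
    apply: (@le_trans _ _ (C%:E * (eta / (C + 1))%:E)%E).
      by apply: lee_wpmul2l; [rewrite lee_fin|exact: ltW].
    by rewrite -EFinM lee_fin mulrCA ger_pMr// ler_pdivrMr//; lra.
(* [E] need not be Borel: a Borel null set around [S] and [E]'s intersection is obtained by
   intersecting covers of mass at most 1/(n+1). *)
have /choice[U HU] (n : nat) : exists U : set (measurableTypeR R),
    [/\ measurable U, S `&` E `<=` U & (mu U <= n.+1%:R^-1%:E)%E].
  by apply: cover; rewrite invr_gt0.
exists (\bigcap_n U n); split.
- by apply: bigcap_measurable => // n _; have [] := HU n.
- apply/eqP; rewrite eq_le measure_ge0 andbT.
  apply/lee_addgt0Pr => e e0; rewrite add0e.
  have [n] := ltr_add_invr e0; rewrite add0r => ne.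
  have [mU _ muU] := HU n.
  apply: (@le_trans _ _ (mu (U n))); last first.
    by apply: le_trans muU _; rewrite lee_fin ltW.
  apply: le_measure; rewrite ?inE//.
    by apply: bigcap_measurable => // k _; have [] := HU k.
  by move=> x; apply.
- by move=> x SEx n _; have [_ + _] := HU n; apply.
Qed.

End HausdorffNullSets.

(** * Poisson kernel estimates and boundary growth *)

Section BoundaryGrowth.
Variable R : realType.
Implicit Types (M : R[i] -> R[i]) (mu : borel_measure R) (l e : R).

Lemma continuous_poisson_kernel l e : 0 < e ->
  continuous (fun x : R => e / ((x - l) ^+ 2 + e ^+ 2)).
Proof.
move=> e0 x; apply: cvgM; first exact: cvg_cst.
apply: cvgV.
  by rewrite gt_eqF// ltr_wpDl ?sqr_ge0// exprn_gt0.
apply: cvgD; last exact: cvg_cst.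
by apply: cvgM; apply: cvgB; [exact: cvg_id|exact: cvg_cst
                             |exact: cvg_id|exact: cvg_cst].
Qed.

(** Compares the kernel with the weight of [poisson_finite]. It rests on x^2 <= 2 (x - l)^2 + 2 l^2,
    which is (x - 2 l)^2 >= 0. *)
Lemma poisson_kernel_le l e (x : R) : 0 < e ->
  e / ((x - l) ^+ 2 + e ^+ 2)
  <= e * (2 + (1 + 2 * l ^+ 2) / e ^+ 2) * (1 + x ^+ 2)^-1.
Proof.
move=> e0; have e20 : 0 < e ^+ 2 by rewrite exprn_gt0.
have x0 : 0 <= (x - l) ^+ 2 by exact: sqr_ge0.
rewrite -mulrA ler_pM2l// ler_pdivlMr ?ltr_wpDr ?sqr_ge0//.
rewrite ler_pdivrMl ?ltr_wpDl//.
set q := _ / _.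
have q0 : 0 <= q by rewrite divr_ge0 ?ltW// ltr_wpDr// mulr_ge0 ?sqr_ge0.
have qe : q * e ^+ 2 = 1 + 2 * l ^+ 2 by rewrite divfK// gt_eqF.
have : 0 <= q * (x - l) ^+ 2 by rewrite mulr_ge0.
have : 0 <= (x - 2 * l) ^+ 2 by exact: sqr_ge0.
nra.
Qed.

(** The imaginary part is [A * e] plus the integral of the Poisson kernel, and this kernel is at
    least 1/(2e) on the ball. *)
Lemma closed_ball_le_Im_herglotz M mu l e : 0 < e -> herglotz_measure M mu ->
  (mu `[(l - e)%R, (l + e)%R]%classic <= (2 * e * complex.Im (M (l +i* e)))%:E)%E.
Proof.
move=> e0 [mufin [A [B [A0 ->//]]]].
pose P (x : measurableTypeR R) : R := e / ((x - l) ^+ 2 + e ^+ 2).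
have P0 x : 0 <= P x.
  by rewrite divr_ge0 ?ltW// ltr_wpDl ?sqr_ge0// exprn_gt0.
have mP D : measurable_fun (D : set (measurableTypeR R)) (EFin \o P).
  apply/measurable_EFinP; apply: measurable_funTS.
  by apply: continuous_measurable_fun; exact: continuous_poisson_kernel.
have ImE : complex.Im (A%:C * (l +i* e) + B%:C + cintegral mu
     (fun x => (x%:C - (l +i* e))^-1 - (x / (1 + x ^+ 2))%:C))
     = A * e + fine (\int[mu]_x (P x)%:E)%E.
  rewrite !raddfD /= mul0r addr0 addr0; congr (_ + _).
  rewrite -[RHS]/(Rintegral mu setT P); apply: eq_Rintegral => x _.
  by rewrite sub0r subr0 -mulNr opprK sqrrN.
rewrite ImE.
set C := e * (2 + (1 + 2 * l ^+ 2) / e ^+ 2).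
have C0 : 0 <= C.
  rewrite mulr_ge0 ?(ltW e0)// addr_ge0// divr_ge0 ?sqr_ge0// addr_ge0//.
  by rewrite mulr_ge0 ?sqr_ge0.
(* The integral enters the imaginary part through [fine], which sends [+oo] to 0, so its finiteness
   must be established before it can bound anything. *)
have Pfin : (\int[mu]_x (P x)%:E < +oo)%E.
  have mK : measurable_fun [set: measurableTypeR R]
      (EFin \o (fun x : measurableTypeR R => (1 + (x : R) ^+ 2)^-1)).
    apply/measurable_EFinP; apply: continuous_measurable_fun => x.
    apply: cvgV; first by rewrite gt_eqF// ltr_wpDr ?sqr_ge0.
    apply: cvgD; first exact: cvg_cst.
    by apply: cvgM; exact: cvg_id.
  have K0 x : (0 <= ((1 + x ^+ 2)^-1 : R)%:E)%E.
    by rewrite lee_fin invr_ge0 addr_ge0 ?sqr_ge0.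
  apply: (@le_lt_trans _ _ (C%:E * \int[mu]_x ((1 + x ^+ 2)^-1)%:E)%E).
    rewrite -ge0_integralZl_EFin//; apply: ge0_le_integral => //.
    - by move=> x _; rewrite lee_fin.
    - exact: measurable_funeM.
    - by move=> x _; rewrite -EFinM lee_fin; exact: poisson_kernel_le.
  by apply: lte_mul_pinfty; rewrite ?lee_fin.
have le1 : (mu `[(l - e)%R, (l + e)%R]%classic
            <= (2 * e)%:E * \int[mu]_x (P x)%:E)%E.
  rewrite -ge0_integralZl_EFin//; last 2 first.
  - by move=> x _; rewrite lee_fin.
  - by rewrite mulr_ge0 ?ltW.
  rewrite -[X in (mu X <= _)%E]setIT -integral_indic//.
  apply: ge0_le_integral => //.
  - by apply/measurable_EFinP; exact: measurable_indic.
  - exact: measurable_funeM.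
  move=> x _; rewrite -EFinM lee_fin indicE.
  have [|_] := boolP (_ \in _); last first.
    by rewrite mulr_ge0// mulr_ge0// ltW.
  rewrite inE /= in_itv /= => xle.
  rewrite /P mulrA ler_pdivlMr; last by rewrite ltr_wpDl ?sqr_ge0// exprn_gt0.
  nra.
have Pnum : (\int[mu]_x (P x)%:E)%E \is a fin_num.
  by rewrite ge0_fin_numE// integral_ge0// => x _; rewrite lee_fin.
move: le1; rewrite -(fineK Pnum) -EFinM fineK// => /le_trans; apply.
rewrite lee_fin ler_pM2l ?mulr_gt0// lerDr mulr_ge0// ltW//.
Qed.

(** Below a positive liminf there is a positive constant [c] that bounds e^(k-1) Im M from below for
    small e. As k >= kappa and e <= 1, the exponent 1 - k may be replaced by 1 - kappa. *)
Lemma A_set_growth (kappa : R) M l : A_set kappa M l ->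
  exists c delta : R, [/\ 0 < c, 0 < delta & forall e, 0 < e < delta ->
    c * e `^ (1 - kappa) <= complex.Im (M (l +i* e))].
Proof.
move=> [k /= /andP[kk k1] [/= L0 Loo]].
move: L0 Loo; set L := limf_einf _ _ => L0 Loo.
have Lfin : L \is a fin_num by rewrite ge0_fin_numE // ltW.
have [c c0 cL] : exists2 c : R, 0 < c & (c%:E < L)%E.
  exists (fine L / 2); first by rewrite divr_gt0// fine_gt0// L0.
  by rewrite -[ltRHS]fineK// lte_fin ltr_pdivrMr// ltr_pMr ?fine_gt0 ?L0// ltr1n.
move: cL; rewrite /L limf_einfE => /ereal_sup_gt[_ [V V0 <-] cV].
have : \forall e \near 0^'+, c * e `^ (1 - kappa) <= complex.Im (M (l +i* e)).
  near=> e.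
  have Ve : V e by near: e.
  have e0 : 0 < e by near: e; exact: nbhs_right_gt.
  have e1 : e <= 1 by near: e; exact: nbhs_right_le.
  have ce : c <= e `^ (k - 1) * complex.Im (M (l +i* e)).
    rewrite -lee_fin; apply: le_trans (ltW cV) _.
    by apply: ereal_inf_lbound; exists e.
  apply: (@le_trans _ _ (c * e `^ (1 - k))).
    by rewrite ler_pM2l// ger_powR ?e0// lerD2l lerN2.
  rewrite -opprB powRN -ler_pdivlMr ?invr_gt0 ?powR_gt0//.
  by rewrite invrK mulrC.
move=> [d /= d0 H]; exists c, d; split=> // e /andP[e0 ed].
by apply: H => //=; rewrite sub0r normrN gtr0_norm.
Unshelve. all: by end_near. Qed.

End BoundaryGrowth.

(** * Exponentials of traceless matrices and their Moebius maps *)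

Section Sl2Exponential.
Variable R : realType.
Implicit Types (X : 'M[R]_2) (D : R).

Lemma det_mx22 X : \det X = X 0 0 * X 1 1 - X 0 1 * X 1 0.
Proof.
rewrite (expand_det_row _ 0) !big_ord_recl big_ord0 addr0 /cofactor !det_mx11.
rewrite !mxE /= expr0 expr1 mul1r mulN1r mulrN.
by congr (_ * X _ _ - X _ _ * X _ _); exact: val_inj.
Qed.

(** Cayley-Hamilton for trace zero. *)
Lemma sl2_generator_sqr (a b c : R) :
  sl2_generator a b c *m sl2_generator a b c
  = (- \det (sl2_generator a b c))%:M.
Proof.
rewrite det_mx22; apply/matrixP => i j; rewrite !mxE !big_ord_recl big_ord0 !mxE/=.
by case: i => -[|[|[]]] // ?; case: j => -[|[|[]]] // ? /=;
  rewrite ?mulr1n ?mulr0n; ring.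
Qed.

Lemma exp_sqr_scalar X D n : X * X = D%:M ->
  X ^+ n = if odd n then D ^+ n./2 *: X else (D ^+ n./2)%:M.
Proof.
move=> XD; elim: n => [|n IH]; first by rewrite expr0.
rewrite exprS IH /= uphalf_half; case: (odd n) => /=.
  by rewrite -scalerAr XD add1n exprS mulrC scale_scalar_mx.
by rewrite add0n -scalemx1 -scalerAr mulr1.
Qed.

(** The odd series sums to sinh(sqrt D)/sqrt D, the even one to cosh(sqrt D), with sin(w)/w and
    cos(w) for D = -w^2. Terms of the wrong parity are kept as zeros, to match the exponential
    series index by index. *)
Definition mxexp_odd_coeff D (n : nat) : R := (odd n)%:R * D ^+ n./2 / n`!%:R.
Definition mxexp_even_coeff D (n : nat) : R := (~~ odd n)%:R * D ^+ n./2 / n`!%:R.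

(** The base is at least 1, so the halved exponent may be raised to n; this makes the exponential
    series at this base a majorant. *)
Lemma expr_half_le_expr D n : `|D ^+ n./2| <= (1 + `|D|) ^+ n.
Proof.
have D1 : 1 <= 1 + `|D| by rewrite lerDl.
rewrite normrX; apply: (@le_trans _ _ ((1 + `|D|) ^+ n./2)).
  by rewrite lerXn2r ?nnegrE ?addr_ge0// lerDr.
by rewrite ler_weXn2l// -{2}(odd_double_half n) -addnn addnA leq_addl.
Qed.

Lemma is_cvg_series_bool_half (b : nat -> bool) D :
  cvgn (series (fun n => (b n)%:R * D ^+ n./2 / n`!%:R)).
Proof.
apply: normed_cvg; apply: series_le_cvg (is_cvg_series_exp_coeff (1 + `|D|)).
- by move=> n; exact: normr_ge0.
- by move=> n; rewrite divr_ge0 ?exprn_ge0 ?addr_ge0.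
move=> n /=; rewrite normrM normfV (ger0_norm (ler0n _ _)) /exp_coeff /=.
rewrite ler_pM2r ?invr_gt0 ?ltr0n ?fact_gt0//.
rewrite normrM; case: (b n); rewrite ?normr1 ?mul1r ?normr0 ?mul0r.
  exact: expr_half_le_expr.
by rewrite exprn_ge0 ?addr_ge0.
Qed.

(** Powers of [X] alternate between scalar matrices and multiples of [X], so the exponential series
    splits by parity. *)
Lemma mxexp_sqr_scalar X D : X * X = D%:M ->
  mxexp X = (limn (series (mxexp_even_coeff D)))%:M
            + limn (series (mxexp_odd_coeff D)) *: X.
Proof.
move=> XD; rewrite /mxexp; apply: cvg_lim; first exact: norm_hausdorff.
rewrite -scalemx1.
have -> : series (fun n => n`!%:R^-1 *: X ^+ n) =
    fun n => series (mxexp_even_coeff D) n *: 1%:M + series (mxexp_odd_coeff D) n *: X.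
  apply/funext => n; rewrite /series /= !scaler_suml -big_split /=.
  apply: eq_bigr => i _; rewrite (exp_sqr_scalar _ XD).
  rewrite /mxexp_even_coeff /mxexp_odd_coeff; case: (odd i) => /=.
    by rewrite !mul0r scale0r add0r mul1r scalerA mulrC.
  by rewrite !mul0r scale0r addr0 mul1r -scalemx1 scalerA mulrC.
apply: cvgD; apply: cvgZr_tmp; exact: is_cvg_series_bool_half.
Qed.

(** For D >= 0 the terms are nonnegative and the one of index 1 equals 1. For D = -w^2 < 0 the sum
    is sin(w)/w with 0 < w < pi. *)
Lemma limn_odd_coeff_gt0 D : (D < 0 -> Num.sqrt (- D) < pi) ->
  0 < limn (series (mxexp_odd_coeff D)).
Proof.
move=> Dpi; have cv : cvgn (series (mxexp_odd_coeff D)).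
  exact: is_cvg_series_bool_half.
case: (leP 0 D) => D0.
  apply: (@lt_le_trans _ _ (series (mxexp_odd_coeff D) 2)).
    rewrite /series /= !big_nat_recr//= big_geq// /mxexp_odd_coeff /=.
    by rewrite !mul0r !add0r mul1r expr0 divr1.
  apply: nondecreasing_cvgn_le cv _.
  apply/nondecreasing_seqP => n; rewrite /series /= big_nat_recr//= lerDl.
  by rewrite !mulr_ge0 ?invr_ge0 ?exprn_ge0.
set w := Num.sqrt (- D) in Dpi.
have w0 : 0 < w by rewrite sqrtr_gt0 oppr_gt0.
have wD : D = - w ^+ 2 by rewrite sqr_sqrtr ?opprK// oppr_ge0 ltW.
have : sin w = w * limn (series (mxexp_odd_coeff D)).
  rewrite unlock; apply: cvg_lim; first exact: norm_hausdorff.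
  have -> : series (sin_coeff w) = fun n => w * series (mxexp_odd_coeff D) n.
    apply/funext => n; rewrite /series /= mulr_sumr; apply: eq_bigr => i _.
    rewrite /sin_coeff /mxexp_odd_coeff /=; case oi: (odd i); last first.
      by rewrite !mul0r mulr0.
    rewrite !mul1r mulrA; congr (_ / _).
    rewrite wD -(odd_double_half i) oi add1n /=.
    by rewrite doubleK uphalf_double (exprNn (w ^+ 2)) exprS -mul2n exprM; ring.
  by apply: cvgMl_tmp.
by move=> sinw; rewrite -(pmulr_rgt0 _ w0) -sinw sin_gt0_pi// w0 Dpi.
Qed.

(** The entry is [t * c] times the odd series at D = -t^2 det. When D < 0, the bound on t yields w =
    |t| sqrt(det) < pi. *)
Lemma mxexp_sl2_generator_lowerleft_neq0 (a b c t : R) :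
  c != 0 -> t != 0 ->
  (0 < \det (sl2_generator a b c) ->
   `|t| < pi / (2 * Num.sqrt (\det (sl2_generator a b c)))) ->
  mxexp (t *: sl2_generator a b c) 1 0 != 0.
Proof.
move=> c0 t0 tsmall; set d := \det _ in tsmall.
have sqr : t *: sl2_generator a b c * (t *: sl2_generator a b c)
           = (- (t ^+ 2 * d))%:M.
  rewrite -scalerAl -scalerAr -mulmxE sl2_generator_sqr scalerA -expr2.
  by rewrite scale_scalar_mx mulrN.
rewrite (mxexp_sqr_scalar sqr) !mxE/= mulr0n add0r mulf_neq0 ?mulf_neq0//.
rewrite gt_eqF// limn_odd_coeff_gt0// oppr_lt0 opprK => td0.
have d0 : 0 < d by move: td0; rewrite pmulr_rgt0// exprn_even_gt0.
rewrite sqrtrM ?sqr_ge0// sqrtr_sqr.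
have s0 : 0 < Num.sqrt d by rewrite sqrtr_gt0.
have := tsmall d0; rewrite ltr_pdivlMr ?mulr_gt0// => h.
apply: le_lt_trans h; rewrite ler_pM2l ?normr_gt0// mulr2n mulrDl mul1r.
by rewrite lerDl ltW.
Qed.

(** Im G(z) = det(G) Im z / |c z + d|^2, and the denominator is at least (c Im z)^2. The absolute
    value covers either sign of the determinant. *)
Lemma Im_moebius_mul_le (G : 'M[R]_2) (z : R[i]) : G 1 0 != 0 ->
  0 < complex.Im z ->
  complex.Im (moebius G z) * complex.Im z <= `|\det G| / G 1 0 ^+ 2.
Proof.
case: z => x y /= c0 y0; rewrite /moebius det_mx22.
set a := G 0 0; set b := G 0 1; set c := G 1 0; set d := G 1 1.
have cy : 0 < (c * y) ^+ 2 by rewrite exprn_even_gt0// mulf_neq0// gt_eqF.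
set N := (c * x + d) ^+ 2 + (c * y) ^+ 2.
have N0 : 0 < N by rewrite ltr_wpDl ?sqr_ge0.
rewrite !mul0r !subr0 !addr0 -/N.
have -> : ((a * x + b) * - (c * y / N) + a * y * ((c * x + d) / N)) * y
          = (a * d - b * c) * y ^+ 2 / N by ring.
have c20 : 0 < c ^+ 2 by rewrite exprn_even_gt0.
rewrite ler_pdivrMr// mulrAC ler_pdivlMr//.
have -> : (a * d - b * c) * y ^+ 2 * c ^+ 2 = (a * d - b * c) * (c * y) ^+ 2 by ring.
apply: (@le_trans _ _ (`|a * d - b * c| * (c * y) ^+ 2)).
  by rewrite ler_pM2r// ler_norm.
by rewrite ler_wpM2l// lerDr sqr_ge0.
Qed.

End Sl2Exponential.

(** * Null sets of the transformed Herglotz measure *)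

Lemma moebius_herglotz_measure_null (R : realType) (G : 'M[R]_2)
    (M : R[i] -> R[i]) (kappa : R) (mu : borel_measure R)
    (S : set (measurableTypeR R)) :
  G 1 0 != 0 -> herglotz M -> 0 < kappa ->
  herglotz_measure (moebius G \o M) mu -> hausdorff_measure kappa S = 0%E ->
  mu.-negligible (S `&` A_set kappa M).
Proof.
move=> c0 HM k0 Hmu S0; set K := `|\det G| / G 1 0 ^+ 2.
have K0 : 0 <= K by rewrite divr_ge0 ?sqr_ge0.
(* The growth constants depend on the point, whereas the mass distribution principle needs uniform
   ones; the sets [E n] fix the constant n and the threshold 1/(n+1), and countably many of them
   suffice. *)
pose E n := [set l : R | forall e : R, 0 < e < n.+1%:R^-1 ->
  (mu `[(l - e)%R, (l + e)%R]%classic <= (n%:R * e `^ kappa)%:E)%E].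
apply: (@negligibleS _ _ _ _ (\bigcup_n (S `&` E n))); last first.
  apply: negligible_bigcup => n.
  by apply: (mass_distribution k0 _ _ S0) => [||l]; [|exact: ler0n|exact].
move=> l [Sl /A_set_growth[c [d [c_gt0 d_gt0 growth]]]].
have [n nd] : exists n : nat, n.+1%:R^-1 < d.
  by have [n] := ltr_add_invr d_gt0; rewrite add0r; exists n.
(* One index serves both purposes: radii below 1/(m+1) are below [d], and [m] exceeds the constant
   2K/c of the final estimate. *)
pose m := maxn n (Num.truncn (2 * K / c)).+1.
exists m => //; split=> // e /andP[e0 em].
have mK : 2 * K / c <= m%:R.
  apply: ltW; apply: lt_le_trans (truncnS_gt _) _.
  by rewrite ler_nat leq_maxr.
have ed : e < d.
  apply: lt_trans em _; apply: le_lt_trans nd.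
  by rewrite lef_pV2 ?posrE// ler_nat ltnS leq_maxl.
apply: le_trans (closed_ball_le_Im_herglotz l e0 Hmu) _; rewrite lee_fin /=.
have le : upper_half_plane (l +i* e) by [].
have [_ ImM] := HM _ le.
have Mge : c * e `^ (1 - kappa) <= complex.Im (M (l +i* e)).
  by apply: growth; rewrite e0.
have := Im_moebius_mul_le c0 ImM; rewrite -/K => ImK.
have ImMt : complex.Im (moebius G (M (l +i* e))) <= K / (c * e `^ (1 - kappa)).
  rewrite -ler_pdivlMr// in ImK; apply: le_trans ImK _.
  by rewrite ler_wpM2l// lef_pV2// posrE mulr_gt0// powR_gt0.
apply: (@le_trans _ _ (2 * e * (K / (c * e `^ (1 - kappa))))).
  by rewrite ler_pM2l// mulr_gt0.
have -> : 2 * e * (K / (c * e `^ (1 - kappa))) = 2 * K / c * e `^ kappa.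
  rewrite powRB; last by rewrite (gt_eqF e0) implybT.
  rewrite powRr1 ?ltW//; field.
  by rewrite !gt_eqF// powR_gt0.
by rewrite ler_wpM2r ?powR_ge0.
Qed.

Theorem lemma4p2 (R : realType) (alpha beta gamma : R) (M0 : R[i] -> R[i])
    (kappa : R)
    (gamma0 : gamma != 0)
    (herglotzM0 : herglotz M0)
    (kappa01 : 0 < kappa < 1)
    (borelA : measurable (A_set kappa M0))
    (posA : (0 < lebesgue_measure (A_set kappa M0))%E)
    (t : R)
    (mu musc musc_kc musc_ks : borel_measure R)
    (mu_t : herglotz_measure
              (moebius (mxexp (t *: sl2_generator alpha beta gamma)) \o M0) mu)
    (mu_sc : sc_part mu musc)
    (mu_sc_kappa : kappa_decomposition kappa musc musc_kc musc_ks)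
    (t0 : t != 0)
    (t_small : 0 < \det (sl2_generator alpha beta gamma) ->
       `|t| < pi / (2 * Num.sqrt (\det (sl2_generator alpha beta gamma))))
    (Delta : set (measurableTypeR R))
    (borelD : measurable Delta)
    (boundedD : bounded_set (Delta : set R)) :
  musc (Delta `&` A_set kappa M0) = musc_kc (Delta `&` A_set kappa M0).
Proof.
have [k0 _] := andP kappa01.
have [_ [muac [mupp [_ _ muE]]]] := mu_sc.
have [_ [S [mS S0 ksS]] muscE] := mu_sc_kappa.
have mDA : measurable (Delta `&` A_set kappa M0) by exact: measurableI.
have c0 := mxexp_sl2_generator_lowerleft_neq0 gamma0 t0 t_small.
have mSA : measurable (S `&` A_set kappa M0) by exact: measurableI.
have muSA : mu (S `&` A_set kappa M0) = 0%E.
  apply/negligibleP => //.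
  exact: moebius_herglotz_measure_null c0 herglotzM0 k0 mu_t S0.
(* As all parts are nonnegative, [musc_ks] <= [musc] <= [mu] on Borel sets. *)
have ksSA : musc_ks (S `&` A_set kappa M0) = 0%E.
  apply/eqP; rewrite eq_le measure_ge0 andbT -muSA muE// muscE//.
  by rewrite addeA addeAC (addeC (muac _)) -!addeA leeDl// !adde_ge0.
rewrite muscE// -[RHS]adde0; congr (_ + _)%E.
apply/eqP; rewrite eq_le measure_ge0 andbT.
(* Points of [A_set] lie either in [S], where the previous bound applies, or in the complement of
   [S], which does not charge [musc_ks] by singularity. *)
apply: (@le_trans _ _ (musc_ks (S `&` A_set kappa M0 `|` ~` S))).
  apply: le_measure; rewrite ?inE//.
    by apply: measurableU => //; exact: measurableC.
  by move=> x [_ Ax]; have [Sx|Sx] := pselect (S x); [left|right].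
apply: le_trans (measureU2 musc_ks mSA (measurableC mS)) _.
by rewrite -[leRHS]adde0; apply: leeD; [rewrite -[leRHS]ksSA|rewrite -[leRHS]ksS].
Qed.
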